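(* Let $\gamma: I\to H^n(-1)$ be a curve in the $n$-dimensional hyperbolic space of constant sectional curvature $-1$, parametrized by its arclength, with Frenet curvatures $k_1,k_2,k_3,\dots$, and let $f:I\to(0,\infty)$ be a smooth function. Then $\gamma$ is a bi-$f$-harmonic curve if and only if $$\left\{\begin{array}{l} -3k_1k_1'f^2-4k_1^2ff'+ff'''+f'f''=0,\\ -k_1^3f^2-k_1k_2^2f^2+k_1''f^2-k_1f^2+4k_1'ff'+3k_1ff''+2k_1(f')^2=0,\\ 2k_1'k_2f+k_1k_2'f+4k_1k_2f'=0,\\ k_1k_2k_3=0. \end{array}\right.$$
   Context: $I\subset\mathbb{R}$ is an open interval, and $\gamma:I\to (N,h)$ is a smooth curve parametrized by arclength in an $n$-dimensional Riemannian manifold (here $N=H^n(-1)$), with unit tangent $T=\gamma'$; $\nabla^N$ is the Levi-Civita connection and $R^N(X,Y)=[\nabla_X,\nabla_Y]-\nabla_{[X,Y]}$ is the curvature operator. For a smooth function $f:I\to(0,\infty)$, the $f$-tension field of $\gamma$ is $\tau_f(\gamma)=f\,\nabla^N_TT+f'T$. The curve $\gamma$ is called bi-$f$-harmonic if it is a critical point of the bi-$f$-energy $\frac12\int|\tau_f(\gamma)|^2\,dt$ (over compact subdomains), i.e. if it satisfies the Euler-Lagrange equation $\nabla^N_T\big(f\,\nabla^N_T\tau_f(\gamma)\big)+f\,R^N(\tau_f(\gamma),T)T=0$. Frenet frame: $\{E_1,\dots,E_n\}$ is an orthonormal frame along $\gamma$ with $E_1=T$ satisfying $\nabla^N_TE_1=k_1E_2$,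 $\nabla^N_TE_r=-k_{r-1}E_{r-1}+k_rE_{r+1}$ for $2\le r\le n-1$, $\nabla^N_TE_n=-k_{n-1}E_{n-1}$, where $k_1=\|\nabla^N_TE_1\|$ and $k_2,\dots,k_{n-1}$ are non-negative (smooth) real functions on $I$, the curvatures of $\gamma$; curvatures $k_r$ with $r\ge n$ are read as $0$. Primes denote derivatives with respect to the arclength parameter. *)

(* Defs.v *)
From HB Require Import structures.
From mathcomp Require Import all_boot all_order all_algebra.
From mathcomp Require Import all_classical all_reals all_analysis.

Set Implicit Arguments.
Unset Strict Implicit.
Unset Printing Implicit Defensive.

Import Order.TTheory GRing.Theory Num.Theory.
Import numFieldNormedType.Exports.

Local Open Scope classical_set_scope.
Local Open Scope ring_scope.

(* [I] is meant to be open, so that the (two-sided) derivatives at points of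
   [I] only depend on the restriction of [F] to [I]. *)
Definition smooth_on (R : realType) (V : normedModType R) (I : set R)
    (F : R -> V) : Prop :=
  forall (m : nat) (t : R), I t -> derivable (derive1n m F) t 1.

(* Riemannian geometry in one global chart: the manifold is an open subset of
   R^n, tangent vectors are row vectors and [g x] is the Gram matrix at [x] of
   the coordinate fields. *)
Section Riemannian.
Variables (R : realType) (n : nat).
Implicit Types (g : 'rV[R]_n -> 'M[R]_n) (x u v w : 'rV[R]_n).
Implicit Types (X Y Z : 'rV[R]_n -> 'rV[R]_n) (gam V : R -> 'rV[R]_n).

Definition inner g x u v : R := (u *m g x *m v^T) 0 0.

Definition gnorm g x u : R := Num.sqrt (inner g x u u).

Definition partial (i : 'I_n) (F : 'rV[R]_n -> R) x : R :=
  'D_(delta_mx 0 i) F x.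

(* Gamma^l_(i j) of the Levi-Civita connection *)
Definition christoffel g x (l i j : 'I_n) : R :=
  2^-1 * \sum_(m < n) invmx (g x) l m *
    (partial i (fun y => g y j m) x + partial j (fun y => g y i m) x
     - partial m (fun y => g y i j) x).

Definition christoffel_form g x u v : 'rV[R]_n :=
  \row_l \sum_(i < n) \sum_(j < n) christoffel g x l i j * u 0 i * v 0 j.

Definition nabla g X Y : 'rV[R]_n -> 'rV[R]_n :=
  fun x => 'D_(X x) Y x + christoffel_form g x (X x) (Y x).

Definition lie_bracket X Y : 'rV[R]_n -> 'rV[R]_n :=
  fun x => 'D_(X x) Y x - 'D_(Y x) X x.

Definition curvature_field g X Y Z : 'rV[R]_n -> 'rV[R]_n :=
  fun x => nabla g X (nabla g Y Z) x - nabla g Y (nabla g X Z) x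
           - nabla g (lie_bracket X Y) Z x.

(* The value of the curvature tensor on tangent vectors at [x]: by tensoriality
   any extension to vector fields may be used; we take the fields with constant
   coordinates. *)
Definition curvature g x u v w : 'rV[R]_n :=
  curvature_field g (fun=> u) (fun=> v) (fun=> w) x.

(* nabla_T V for a vector field [V] along the curve [gam], with T = gam' *)
Definition covariant g gam V : R -> 'rV[R]_n :=
  fun t => derive1 V t + christoffel_form g (gam t) (derive1 gam t) (V t).

Definition f_tension g gam (f : R -> R) : R -> 'rV[R]_n :=
  fun t => f t *: covariant g gam (derive1 gam) t + derive1 f t *: derive1 gam t.

(* the Euler-Lagrange equation of the bi-f-energy *)
Definition bi_f_harmonic g (I : set R) gam (f : R -> R) : Prop :=
  forall t, I t ->
    covariant g gam
      (fun s => f s *: covariant g gam (f_tension g gam f) s) t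
    + f t *: curvature g (gam t) (f_tension g gam f t)
        (derive1 gam t) (derive1 gam t)
    = 0.

Definition arclength_curve g (M : set 'rV[R]_n) (I : set R) gam : Prop :=
  [/\ smooth_on I gam,
      forall t, I t -> M (gam t) &
      forall t, I t -> gnorm g (gam t) (derive1 gam t) = 1].

(* Frame fields and curvatures are numbered from 1: only [E 1], ..., [E n]
   and [k 1], [k 2], ... are meaningful, with [k r] = 0 for [r >= n]. *)
Record frenet_frame g (I : set R) gam (E : nat -> R -> 'rV[R]_n)
    (k : nat -> R -> R) : Prop := FrenetFrame {
  frenet_smooth : forall r, (1 <= r <= n)%N -> smooth_on I (E r);
  frenet_orthonormal : forall r s, (1 <= r <= n)%N -> (1 <= s <= n)%N ->
    forall t, I t -> inner g (gam t) (E r t) (E s t) = (r == s)%:R;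
  frenet_tangent : forall t, I t -> E 1%N t = derive1 gam t;
  frenet_first : forall t, I t -> covariant g gam (E 1%N) t = k 1%N t *: E 2%N t;
  frenet_middle : forall r, (2 <= r <= n.-1)%N -> forall t, I t ->
    covariant g gam (E r) t = - k r.-1 t *: E r.-1 t + k r t *: E r.+1 t;
  frenet_last : (2 <= n)%N -> forall t, I t ->
    covariant g gam (E n) t = - k n.-1 t *: E n.-1 t;
  frenet_k1 : forall t, I t ->
    k 1%N t = gnorm g (gam t) (covariant g gam (E 1%N) t);
  frenet_k_smooth : forall r, (1 <= r < n)%N -> smooth_on I (k r);
  frenet_k_ge0 : forall r, (2 <= r < n)%N -> forall t, I t -> 0 <= k r t;
  frenet_k_out : forall r, (n <= r)%N -> forall t, I t -> k r t = 0
}.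

End Riemannian.

(* H^n(-1), with n = m.+1, in the upper half-space model:
   {x | x_n > 0} with the metric (dx_1^2 + ... + dx_n^2) / x_n^2. *)
Definition hyperbolic_space (R : realType) (m : nat) : set 'rV[R]_m.+1 :=
  [set x | 0 < x 0 ord_max].

Definition hyperbolic_metric (R : realType) (m : nat) (x : 'rV[R]_m.+1) :
    'M[R]_m.+1 :=
  ((x 0 ord_max ^+ 2)^-1)%:M.

(* Main.v *)
Require Import Defs.
From HB Require Import structures.
From mathcomp Require Import all_boot all_order all_algebra.
From mathcomp Require Import all_classical all_reals all_analysis.
From mathcomp Require Import ring.

Set Implicit Arguments.
Unset Strict Implicit.
Unset Printing Implicit Defensive.

Import Order.TTheory GRing.Theory Num.Theory.
Import numFieldNormedType.Exports.

Local Open Scope classical_set_scope.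
Local Open Scope ring_scope.

(** The theorem is a computation in the Frenet frame.  Writing T = E 1 and
    tau for the f-tension field, the relation nabla_T T = k 1 E 2 gives

      tau = f' E 1 + f k 1 E 2,

    and two further applications of the Leibniz rule and of the Frenet equations
    expand nabla_T (f nabla_T tau) over E 1, ..., E 4: each differentiation reaches
    at most one vector further.  The only geometric input is the curvature term.
    Since H^n has constant curvature -1, R(tau, T)T = <tau, T> T - tau
    = - f k 1 E 2, so that this term only modifies the coefficient of E 2
    ([hyperbolic_curvature], proved in the half-space model by computing the
    Christoffel symbols).  The resulting four coefficients
    ([euler_lagrange_frenet]) are the four left-hand sides, the last two
    multiplied by f and f ^ 2, which do not vanish; an orthonormal frame being
    linearly independent ([frame_free]), the field vanishes exactly when they do.

    In dimension n < 4 the vectors E r with n < r are arbitrary.  This is harmless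
    because, for r > 1, every term of the coefficient of E r contains k r.-1 or one
    of its derivatives, all zero on I once n < r ([euler_lagrange_coef_out]). *)

(** * Calculus on an open set *)

Section Calculus.
Context {R : realType}.

Lemma is_derive_coord (V : normedModType R) n (F : V -> 'rV[R]_n)
    (x v : V) (dF : 'rV[R]_n) :
  is_derive x v F dF <->
  forall j, is_derive x v (fun y => F y 0 j) (dF 0 j).
Proof.
split=> [[Fd <-] j|Fd].
  apply: DeriveDef; first by move/derivable_mxP : Fd.
  by rewrite derive_mx // mxE.
have Fdx : derivable F x v.
  by apply/derivable_mxP => i j; rewrite (ord1 i); case: (Fd j).
apply: DeriveDef => //; rewrite derive_mx //.
by apply/rowP => j; rewrite mxE; case: (Fd j).
Qed.

(** The product, sum and difference rules are restated on eta-expanded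
    functions, so that the derivative of a nested expression is obtained by
    composing the rules as terms, with no unification against the pointwise
    ring structure of functions. *)
Lemma is_deriveMfun (V : normedModType R) (a b : V -> R) (x v : V)
    (da db : R) :
  is_derive x v a da -> is_derive x v b db ->
  is_derive x v (fun y => a y * b y) (da * b x + a x * db).
Proof.
move=> ad bd; apply: (@is_derive_eq _ _ _ (a * b)).
by rewrite addrC mulrC.
Qed.

Lemma is_deriveDfun (V W : normedModType R) (F G : V -> W) (x v : V)
    (dF dG : W) :
  is_derive x v F dF -> is_derive x v G dG ->
  is_derive x v (fun y => F y + G y) (dF + dG).
Proof. exact: is_deriveD. Qed.

Lemma is_deriveBfun (V W : normedModType R) (F G : V -> W) (x v : V)
    (dF dG : W) :
  is_derive x v F dF -> is_derive x v G dG ->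
  is_derive x v (fun y => F y - G y) (dF - dG).
Proof. exact: is_deriveB. Qed.

(** Leibniz rule for a vector-valued function with a variable scalar factor,
    read off coordinatewise from the scalar product rule. *)
Lemma is_derive_scale (V : normedModType R) n (a : V -> R)
    (F : V -> 'rV[R]_n) (x v : V) (da : R) (dF : 'rV[R]_n) :
  is_derive x v a da -> is_derive x v F dF ->
  is_derive x v (fun y => a y *: F y) (da *: F x + a x *: dF).
Proof.
move=> ad /is_derive_coord Fd; apply/is_derive_coord => j.
rewrite !mxE (_ : (fun _ => _) = (fun s => a s * F s 0 j)).
  exact: is_deriveMfun.
by apply/funext => s; rewrite mxE.
Qed.

Lemma smooth_is_derive (V : normedModType R) (I : set R) (F : R -> V)
    (p : nat) (t : R) :
  smooth_on I F -> I t -> is_derive t 1 (derive1n p F) (derive1n p.+1 F t).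
Proof.
by move=> Fs It; apply: DeriveDef; [exact: Fs|rewrite derive1nS derive1E].
Qed.

Lemma open_near (I : set R) (P : R -> Prop) (t : R) :
  open I -> I t -> (forall s, I s -> P s) -> \forall s \near t, P s.
Proof.
move=> Io It IP; have := open_nbhs_nbhs (conj Io It).
by apply: filterS.
Qed.

(** A curvature [k r] with [n <= r] is only known to vanish on [I]: openness of
    [I] is what makes its two-sided derivatives vanish there too. *)
Lemma derive1n_vanish (V : normedModType R) (I : set R) (F : R -> V) (p : nat) :
  open I -> (forall t, I t -> F t = 0) -> forall t, I t -> derive1n p F t = 0.
Proof.
move=> Io F0; elim: p => [//|p IHp] t It; rewrite derive1nS derive1E.
rewrite (@near_eq_derive _ _ _ _ (cst 0)) ?derive_cst //.
exact: open_near Io It IHp.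
Qed.

Lemma smooth_vanish (V : normedModType R) (I : set R) (F : R -> V) :
  open I -> (forall t, I t -> F t = 0) -> smooth_on I F.
Proof.
move=> Io F0 p t It; apply: (@near_eq_derivable _ _ _ (cst 0)).
  by apply: (open_near Io It) => s Is; rewrite (derive1n_vanish _ Io).
exact: derivable_cst.
Qed.

End Calculus.

(** * The covariant derivative along a curve *)

Section Covariant.
Context {R : realType} {n : nat}.
Variable g : 'rV[R]_n -> 'M[R]_n.
Implicit Types (t : R) (x u v w : 'rV[R]_n) (gam V W : R -> 'rV[R]_n).

Lemma christoffel_form_is_linear x u : linear (christoffel_form g x u).
Proof.
move=> a v w; apply/rowP => l; rewrite !mxE mulr_sumr -big_split /=.
apply: eq_bigr => i _; rewrite mulr_sumr -big_split /=.
by apply: eq_bigr => j _; rewrite !mxE; ring.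
Qed.

HB.instance Definition _ x u :=
  GRing.isLinear.Build R _ _ _ (christoffel_form g x u)
    (christoffel_form_is_linear x u).

Lemma innerDZl x (a b : R) u v w :
  inner g x (a *: u + b *: v) w = a * inner g x u w + b * inner g x v w.
Proof. by rewrite /inner !mulmxDl -!scalemxAl !mxE. Qed.

Lemma inner_suml x v (J : Type) (r : seq J) (c : J -> R) (V : J -> 'rV[R]_n) :
  inner g x (\sum_(j <- r) c j *: V j) v = \sum_(j <- r) c j * inner g x (V j) v.
Proof.
rewrite /inner !mulmx_suml summxE; apply: eq_bigr => j _.
by rewrite -!scalemxAl mxE.
Qed.

(** [covariant] is a total function built on an unspecified limit when the field
    is not differentiable, so it satisfies no unconditional Leibniz rule.  Bundling
    its value with differentiability gives a relation that is closed under sums,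
    products by functions and local modification. *)
Definition covariant_along gam V (t : R) w : Prop :=
  exists2 dV, is_derive t 1 V dV &
    dV + christoffel_form g (gam t) (derive1 gam t) (V t) = w.

Lemma covariant_alongE gam V t w :
  covariant_along gam V t w -> covariant g gam V t = w.
Proof.
by move=> [dV dVP <-]; rewrite /covariant derive1E; case: dVP => _ ->.
Qed.

Lemma covariant_alongP gam V t :
  derivable V t 1 -> covariant_along gam V t (covariant g gam V t).
Proof.
by move=> dV; exists (derive1 V t) => //; rewrite derive1E; exact: derivableP.
Qed.

Lemma covariant_alongD gam V W t v w :
  covariant_along gam V t v -> covariant_along gam W t w ->
  covariant_along gam (fun s => V s + W s) t (v + w).
Proof.
move=> [dV dVP <-] [dW dWP <-]; exists (dV + dW); first exact: is_deriveDfun.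
by rewrite linearD /= addrACA.
Qed.

Lemma covariant_alongZ gam V (t : R) w (a : R -> R) (da : R) :
  is_derive t 1 a da -> covariant_along gam V t w ->
  covariant_along gam (fun s => a s *: V s) t (da *: V t + a t *: w).
Proof.
move=> ad [dV dVP <-]; exists (da *: V t + a t *: dV).
  exact: is_derive_scale.
by rewrite linearZ /= scalerDr addrA.
Qed.

(** The frame relations hold on [I] only, so fields get replaced by expressions
    that agree with them near [t], not everywhere. *)
Lemma covariant_along_near gam V W t w :
  (\forall s \near t, V s = W s) ->
  covariant_along gam V t w -> covariant_along gam W t w.
Proof.
move=> VW [dV dVP <-]; exists dV; first exact: near_eq_is_derive dVP.
by rewrite (nbhs_singleton VW).
Qed.

Lemma covariant_along0 gam t : covariant_along gam (fun=> 0) t 0.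
Proof.
by exists 0; [exact: is_derive_cst|rewrite linear0 addr0].
Qed.

End Covariant.

(** * Curvature of the half-space model *)

Section HalfSpace.
Context {R : realType} {m : nat}.
Local Notation gH := (@hyperbolic_metric R m).
Implicit Types (u v w x : 'rV[R]_m.+1).

Local Notation e := (delta_mx 0 ord_max : 'rV[R]_m.+1).
Local Notation last_coord x := (x 0 ord_max).

Definition dot u v : R := (u *m v^T) 0 0.

Lemma dotE u v : dot u v = \sum_i u 0 i * v 0 i.
Proof. by rewrite /dot mxE; apply: eq_bigr => i _; rewrite mxE. Qed.

Lemma dotC u v : dot u v = dot v u.
Proof. by rewrite !dotE; apply: eq_bigr => i _; rewrite mulrC. Qed.

(** The connection coefficients of the half-space are homogeneous of degree -1
    in the last coordinate; this bilinear form is what remains of them once that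
    factor is removed, and it no longer depends on the point. *)
Definition half_space_form u v : 'rV[R]_m.+1 :=
  dot u v *: e - last_coord u *: v - last_coord v *: u.

Lemma hyperbolic_inner x u v :
  inner gH x u v = (last_coord x ^+ 2)^-1 * dot u v.
Proof.
by rewrite /inner /hyperbolic_metric mul_mx_scalar -scalemxAl mxE.
Qed.

Lemma is_derive_last x v :
  is_derive x v (fun y : 'rV[R]_m.+1 => last_coord y) (last_coord v).
Proof. by have := (is_derive_coord id x v v).1 (is_derive_id x v) ord_max. Qed.

Lemma is_derive_inv_last x v : last_coord x != 0 ->
  is_derive x v (fun y : 'rV[R]_m.+1 => (last_coord y)^-1)
    (- (last_coord x ^+ 2)^-1 * last_coord v).
Proof.
move=> x0; have [cd cE] := is_derive_last x v.
apply: DeriveDef; first exact: derivableV.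
by rewrite deriveV // cE.
Qed.

Lemma partial_hyperbolic x (i j l : 'I_m.+1) : last_coord x != 0 ->
  partial i (fun y => gH y j l) x =
  - 2 * (last_coord x ^+ 3)^-1 * (i == ord_max)%:R * (j == l)%:R.
Proof.
move=> x0; rewrite /partial.
have D := is_derive_inv_last (delta_mx 0 i) x0.
rewrite (_ : (fun y => gH y j l) = fun y =>
  ((last_coord y)^-1 * (last_coord y)^-1) * (j == l)%:R); last first.
  by apply/funext => y; rewrite /hyperbolic_metric mxE mulr_natr expr2 invfM.
have [_ ->] := is_deriveMfun (is_deriveMfun D D)
  (is_derive_cst ((j == l)%:R : R) x (delta_mx 0 i)).
rewrite mxE eqxx /= eq_sym; field.
exact: x0.
Qed.

(** Only the derivatives of the metric in the last direction survive, each equal to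
    [- 2 / x_n ^ 3] times the identity; contracting with the inverse metric
    [x_n ^ 2] and halving leaves the factor [1 / x_n]. *)
Lemma christoffel_hyperbolic x (l i j : 'I_m.+1) : last_coord x != 0 ->
  christoffel gH x l i j = (last_coord x)^-1 *
    ((l == ord_max)%:R * (i == j)%:R - (i == ord_max)%:R * (j == l)%:R
     - (j == ord_max)%:R * (i == l)%:R).
Proof.
move=> x0; rewrite /christoffel /hyperbolic_metric invmx_scalar invrK.
rewrite (bigD1 l) //= big1 => [|p pl]; last first.
  by rewrite mxE eq_sym (negPf pl) mul0r.
rewrite !partial_hyperbolic // !mxE eqxx mulr1n addr0; field.
exact: x0.
Qed.

Lemma sum_eq_mul (a : 'I_m.+1 -> R) i :
  \sum_j (j == i)%:R * a j = a i.
Proof.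
rewrite (bigD1 i) //= eqxx mul1r big1 ?addr0 // => j /negPf ->.
by rewrite mul0r.
Qed.

Lemma christoffel_form_hyperbolic x u v : last_coord x != 0 ->
  christoffel_form gH x u v = (last_coord x)^-1 *: half_space_form u v.
Proof.
move=> x0; apply/rowP => l; rewrite !mxE /=.
pose d (i j : 'I_m.+1) : R := (i == j)%:R.
transitivity ((last_coord x)^-1 * \sum_i \sum_j
   (d l ord_max * (d j i * (u 0 i * v 0 j))
    - d i ord_max * (d j l * (u 0 i * v 0 j))
    - d i l * (d j ord_max * (u 0 i * v 0 j)))).
  rewrite mulr_sumr; apply: eq_bigr => i _; rewrite mulr_sumr.
  apply: eq_bigr => j _; rewrite christoffel_hyperbolic // /d (eq_sym j i).
  by ring.
under eq_bigr do rewrite !sumrB -!mulr_sumr !sum_eq_mul.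
rewrite !sumrB -!mulr_sumr !sum_eq_mul -dotE.
by rewrite /d; congr (_ * _); ring.
Qed.

Lemma half_space_formZr a u v : half_space_form u (a *: v) = a *: half_space_form u v.
Proof.
rewrite /half_space_form /dot linearZ -scalemxAr; apply/rowP => l.
by rewrite !mxE; ring.
Qed.

Lemma last_half_space_form u v :
  last_coord (half_space_form u v) = dot u v - 2 * last_coord u * last_coord v.
Proof. by rewrite !mxE !eqxx /=; ring. Qed.

Lemma dot_half_space_form u v w :
  dot u (half_space_form v w) =
  dot v w * last_coord u - last_coord v * dot u w - last_coord w * dot u v.
Proof.
rewrite !(dotE u) !mulr_sumr.
under eq_bigr do rewrite !mxE eqxx /=.
rewrite -[X in X * last_coord u]mulr1.
rewrite -[X in _ = dot v w * 1 * X - _ - _](sum_eq_mul (u 0)).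
rewrite mulr_sumr -!sumrB; apply: eq_bigr => i _.
by rewrite /dot; ring.
Qed.

(** The inner derivative is [1 / x_n] times a constant vector, so differentiating it
    once more only differentiates that factor, which gives the last term. *)
Lemma nabla2_hyperbolic x u v w : last_coord x != 0 ->
  nabla gH (fun=> u) (nabla gH (fun=> v) (fun=> w)) x =
  (last_coord x ^+ 2)^-1 *:
    (half_space_form u (half_space_form v w) - last_coord u *: half_space_form v w).
Proof.
move=> x0.
have nablaE (y : 'rV[R]_m.+1) : last_coord y != 0 ->
    nabla gH (fun=> v) (fun=> w) y = (last_coord y)^-1 *: half_space_form v w.
  move=> y0; rewrite /nabla derive_cst add0r.
  exact: christoffel_form_hyperbolic.
have x_near : nbhs x [set y : 'rV[R]_m.+1 | last_coord y != 0].
  have : (fun z : 'rV[R]_m.+1 => last_coord z) @ x --> last_coord x.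
    exact/differentiable_continuous/differentiable_coord.
  by move/(_ _ (open_nbhs_nbhs (conj (@open_neq R 0) x0))).
rewrite {1}/nabla.
rewrite (@near_eq_derive _ _ _ _ (fun y : 'rV[R]_m.+1 =>
  (last_coord y)^-1 *: half_space_form v w)); last first.
  by apply: filterS x_near => y; exact: nablaE.
have [_ ->] := is_derive_scale (is_derive_inv_last u x0)
  (is_derive_cst (half_space_form v w) x u).
rewrite nablaE // christoffel_form_hyperbolic // half_space_formZr.
rewrite scaler0 addr0 scalerA -invfM -expr2 mulNr scaleNr -scalerA addrC.
by rewrite [RHS]scalerBr.
Qed.

(** Constant sectional curvature -1.  Fields with constant coordinates commute, so
    the curvature is the antisymmetrization of the second derivatives above; the
    terms along the last coordinate axis cancel and the inner products remain. *)
Lemma hyperbolic_curvature x u v w : last_coord x != 0 ->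
  curvature gH x u v w = inner gH x u w *: v - inner gH x v w *: u.
Proof.
move=> x0.
rewrite /curvature /curvature_field !nabla2_hyperbolic //.
have -> : lie_bracket (fun=> u) (fun=> v) = fun=> 0.
  by apply/funext => y; rewrite /lie_bracket !derive_cst subrr.
rewrite {1}/nabla derive0 christoffel_form_hyperbolic //.
rewrite !hyperbolic_inner; apply/rowP => l.
have -> : half_space_form 0 w = 0.
  by rewrite /half_space_form /dot mul0mx !mxE scaler0 !scale0r !subr0.
rewrite scaler0 addr0 !mxE !dot_half_space_form (dotC v u) !eqxx /=.
by ring.
Qed.

End HalfSpace.

(** * The Euler-Lagrange field in the Frenet frame *)

Section FrenetCurve.
Context {R : realType} {n : nat}.
Variables (g : 'rV[R]_n -> 'M[R]_n) (I : set R) (gam : R -> 'rV[R]_n).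
Variables (E : nat -> R -> 'rV[R]_n) (k : nat -> R -> R).
Hypotheses (I_open : open I) (gam_frenet : frenet_frame g I gam E k).
Implicit Types (t s : R).

Lemma frenet_curvature_smooth r : (0 < r)%N -> smooth_on I (k r).
Proof.
move=> r_gt0; have [rn|nr] := ltnP r n.
  by apply: (frenet_k_smooth gam_frenet); rewrite r_gt0.
exact/(smooth_vanish I_open)/(frenet_k_out gam_frenet).
Qed.

Lemma covariant_tangent t (a : R -> R) (da : R) :
  (0 < n)%N -> I t -> is_derive t 1 a da ->
  covariant_along g gam (fun s => a s *: E 1%N s) t
    (da *: E 1%N t + (a t * k 1%N t) *: E 2%N t).
Proof.
move=> n_gt0 It ad; rewrite -scalerA -(frenet_first gam_frenet It).
apply: covariant_alongZ => //; apply: covariant_alongP.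
exact: (frenet_smooth gam_frenet _ (m := 0)).
Qed.

(** One formula serves for every [r > 1], in every dimension: at [r = n] the term
    in [E n.+1] is killed by [k n = 0], and beyond [n], where [E r] may be any
    function at all, the coefficient is required to vanish on [I], so that both
    sides are zero. *)
Lemma covariant_normal r t (a : R -> R) (da : R) :
  (1 < r)%N -> I t -> ((n < r)%N -> forall s, I s -> a s = 0) ->
  is_derive t 1 a da ->
  covariant_along g gam (fun s => a s *: E r s) t
    (da *: E r t +
     a t *: (- k r.-1 t *: E r.-1 t + k r t *: E r.+1 t)).
Proof.
move=> r_gt1 It a0 ad; have [rn|nr] := leqP r n; last first.
  have a_near : \forall s \near t, cst 0 s = a s.
    by apply: (open_near I_open It) => s Is; rewrite a0.
  have [_ <-] := ad; rewrite -(near_eq_derive _ a_near) derive_cst a0 //.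
  rewrite !scale0r addr0; apply: covariant_along_near (covariant_along0 _ _ _).
  by apply: filterS a_near => s <-; rewrite scale0r.
have <- : covariant g gam (E r) t = - k r.-1 t *: E r.-1 t + k r t *: E r.+1 t.
  have [r_lt|r_ge] := leqP r n.-1.
    by rewrite (frenet_middle gam_frenet) // r_gt1.
  have rE : r = n by apply/eqP; rewrite eqn_leq rn; case: (n) r_ge.
  subst r; rewrite (frenet_last gam_frenet) //.
  by rewrite (frenet_k_out gam_frenet (leqnn n) It) scale0r addr0.
apply: covariant_alongZ => //; apply: covariant_alongP.
by apply: (frenet_smooth gam_frenet _ (m := 0)) => //; rewrite rn ltnW.
Qed.

(** Pairing with [E s] isolates [c s]; the vectors beyond the frame carry zero
    coefficients, which lets one sum of fixed length stand for all dimensions. *)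
Lemma frame_free t N (c : nat -> R) : I t ->
  (forall r, (n < r)%N -> c r = 0) ->
  \sum_(1 <= r < N) c r *: E r t = 0 ->
  forall r, (0 < r < N)%N -> c r = 0.
Proof.
move=> It c0 cE0 s sN; have [sn|] := leqP s n; last exact: c0.
have /andP[s_gt0 s_lt] := sN.
have := inner_suml g (gam t) (E s t) (index_iota 1 N) c (E^~ t).
rewrite /= cE0 (bigD1_seq s) ?mem_index_iota ?iota_uniq //=.
rewrite (frenet_orthonormal gam_frenet) ?s_gt0 // eqxx mulr1.
rewrite big_seq_cond big1 => [|r]; last first.
  rewrite mem_index_iota => /andP[/andP[r_gt0 _] /negPf rs].
  have [rn|nr] := leqP r n; last by rewrite c0 ?mul0r.
  by rewrite (frenet_orthonormal gam_frenet) ?r_gt0 ?s_gt0 // rs mulr0.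
by rewrite addr0 /inner !mul0mx mxE => ->.
Qed.

Variable f : R -> R.
Hypotheses (f_smooth : smooth_on I f) (n_gt0 : (0 < n)%N).

Let df t (It : I t) : is_derive t 1 f (derive1 f t).
Proof. exact: (smooth_is_derive 0 f_smooth It). Qed.

Let ddf t (It : I t) : is_derive t 1 (derive1 f) (derive1n 2 f t).
Proof. exact: (smooth_is_derive 1 f_smooth It). Qed.

Let dddf t (It : I t) : is_derive t 1 (derive1n 2 f) (derive1n 3 f t).
Proof. exact: (smooth_is_derive 2 f_smooth It). Qed.

Let dk r t (It : I t) : (0 < r)%N -> is_derive t 1 (k r) (derive1 (k r) t).
Proof. by move=> r0; exact: (smooth_is_derive 0 (frenet_curvature_smooth r0) It). Qed.

Let ddk1 t (It : I t) : is_derive t 1 (derive1 (k 1%N)) (derive1n 2 (k 1%N) t).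
Proof. by exact: (smooth_is_derive 1 (frenet_curvature_smooth (ltn0Sn 0)) It). Qed.

Let k_out r (nr : (n <= r)%N) t (It : I t) : k r t = 0.
Proof. exact: (frenet_k_out gam_frenet nr It). Qed.

Lemma f_tension_frenet t : I t ->
  f_tension g gam f t = derive1 f t *: E 1%N t + (f t * k 1%N t) *: E 2%N t.
Proof.
move=> It.
have gam_near : \forall s \near t, E 1%N s = derive1 gam s.
  by apply: (open_near I_open It) => s /(frenet_tangent gam_frenet).
have covE1 : covariant g gam (derive1 gam) t = covariant g gam (E 1%N) t.
  rewrite /covariant (nbhs_singleton gam_near) derive1E [in RHS]derive1E.
  by rewrite (near_eq_derive _ gam_near).
rewrite /f_tension covE1 (frenet_first gam_frenet It).
by rewrite -(frenet_tangent gam_frenet It) scalerA addrC.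
Qed.

Lemma covariant_f_tension t : I t ->
  f t *: covariant g gam (f_tension g gam f) t =
    (f t * derive1n 2 f t - (f t * k 1%N t) * (f t * k 1%N t)) *: E 1%N t +
    (2 * (f t * derive1 f t) * k 1%N t + f t * f t * derive1 (k 1%N) t) *: E 2%N t +
    (f t * k 1%N t * (f t * k 2%N t)) *: E 3%N t.
Proof.
move=> It.
have T1 := covariant_tangent n_gt0 It (ddf It).
have v2 : (n < 2)%N -> forall s, I s -> f s * k 1%N s = 0.
  by move=> n1 s Is; rewrite (k_out n1 Is) mulr0.
have T2 := covariant_normal (isT : 1 < 2)%N It v2
  (is_deriveMfun (df It) (dk It (ltn0Sn 0))).
have T := covariant_along_near _ (covariant_alongD T1 T2).
rewrite (covariant_alongE (T (f_tension g gam f) _)); last first.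
  by apply: (open_near I_open It) => s /f_tension_frenet.
apply/rowP => l.
by rewrite !mxE /=; ring.
Qed.

(** The coefficient of the Euler-Lagrange field along [E r]: the left-hand side of
    the [r]-th equation, up to the power of [f] that factors out when [r] is 3
    or 4. *)
Definition euler_lagrange_coef t (r : nat) : R :=
  match r with
  | 1 => - 3 * k 1%N t * derive1 (k 1%N) t * f t ^+ 2
         - 4 * k 1%N t ^+ 2 * f t * derive1 f t
         + f t * derive1n 3 f t + derive1 f t * derive1n 2 f t
  | 2 => - k 1%N t ^+ 3 * f t ^+ 2 - k 1%N t * k 2%N t ^+ 2 * f t ^+ 2
         + derive1n 2 (k 1%N) t * f t ^+ 2 - k 1%N t * f t ^+ 2
         + 4 * derive1 (k 1%N) t * f t * derive1 f t
         + 3 * k 1%N t * f t * derive1n 2 f t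
         + 2 * k 1%N t * derive1 f t ^+ 2
  | 3 => f t * (2 * derive1 (k 1%N) t * k 2%N t * f t
                + k 1%N t * derive1 (k 2%N) t * f t
                + 4 * k 1%N t * k 2%N t * derive1 f t)
  | 4 => f t ^+ 2 * (k 1%N t * k 2%N t * k 3%N t)
  | _ => 0
  end.

Lemma euler_lagrange_coef_out t r : I t -> (n < r)%N ->
  euler_lagrange_coef t r = 0.
Proof.
have dk_out q s p : (n <= q)%N -> I s -> derive1n p (k q) s = 0.
  by move=> nq Is; apply: derive1n_vanish Is => // ? /(k_out nq).
move=> It; case: r => [|[|[|[|[|r]]]]] //= nr.
- by move: nr; rewrite ltnS leqNgt n_gt0.
- have /= -> := dk_out 1%N t 2%N nr It; have /= -> := dk_out 1%N t 1%N nr It.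
  by rewrite k_out // expr0n /=; ring.
- by have /= -> := dk_out 2%N t 1%N nr It; rewrite (@k_out 2%N) //; ring.
- by rewrite (@k_out 3%N) //; ring.
Qed.

(** Only the curvature operator of the ambient metric matters, and constant
    curvature -1 enters through the single identity R(tau, T)T = <tau, T> T - tau,
    whose right-hand side is minus the normal part of [tau]: it contributes
    [- k 1 * f ^ 2] along [E 2] and nothing else. *)
Lemma euler_lagrange_frenet t : I t ->
  (forall u v w, curvature g (gam t) u v w =
     inner g (gam t) u w *: v - inner g (gam t) v w *: u) ->
  covariant g gam (fun s => f s *: covariant g gam (f_tension g gam f) s) t
  + f t *: curvature g (gam t) (f_tension g gam f t)
      (derive1 gam t) (derive1 gam t)
  = \sum_(1 <= r < 5) euler_lagrange_coef t r *: E r t.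
Proof.
move=> It curvE.
have d1 := dk It (ltn0Sn 0); have d2 := dk It (ltn0Sn 1).
have T1 := covariant_tangent n_gt0 It
  (is_deriveBfun (is_deriveMfun (df It) (dddf It))
     (is_deriveMfun (is_deriveMfun (df It) d1) (is_deriveMfun (df It) d1))).
have v2 : (n < 2)%N -> forall s, I s ->
    2 * (f s * derive1 f s) * k 1%N s + f s * f s * derive1 (k 1%N) s = 0.
  move=> n1 s Is; have /= -> := derive1n_vanish 1 I_open (k_out n1) Is.
  by rewrite (k_out n1 Is) !mulr0 addr0.
have T2 := covariant_normal (isT : 1 < 2)%N It v2 (is_deriveDfun
  (is_deriveMfun (is_deriveMfun (is_derive_cst (2 : R) t 1)
     (is_deriveMfun (df It) (ddf It))) d1)
  (is_deriveMfun (is_deriveMfun (df It) (df It)) (ddk1 It))).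
have v3 : (n < 3)%N -> forall s, I s -> f s * k 1%N s * (f s * k 2%N s) = 0.
  by move=> n2 s Is; rewrite (k_out n2 Is) !mulr0.
have T3 := covariant_normal (isT : 1 < 3)%N It v3
  (is_deriveMfun (is_deriveMfun (df It) d1) (is_deriveMfun (df It) d2)).
have T := covariant_along_near _ (covariant_alongD (covariant_alongD T1 T2) T3).
have curv_f_tension : curvature g (gam t) (f_tension g gam f t)
    (derive1 gam t) (derive1 gam t) = - (f t * k 1%N t) *: E 2%N t.
  have E11 := frenet_orthonormal gam_frenet (r := 1) (s := 1) n_gt0 n_gt0 It.
  have E21 : f t * k 1%N t * inner g (gam t) (E 2%N t) (E 1%N t) = 0.
    (* for a one-dimensional manifold E 2 is arbitrary, but then k 1 = 0 *)
  have [n1|n2] := leqP n 1; first by rewrite (k_out n1 It) mulr0 mul0r.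
    by rewrite (frenet_orthonormal gam_frenet) ?mulr0 // n2.
  rewrite curvE f_tension_frenet // -(frenet_tangent gam_frenet It).
  by rewrite innerDZl E11 E21 mulr1 addr0 scale1r opprD addNKr scaleNr.
rewrite (covariant_alongE
  (T (fun s => f s *: covariant g gam (f_tension g gam f) s) _)); last first.
  by apply: (open_near I_open It) => s /covariant_f_tension.
rewrite curv_f_tension 3?big_nat_recl // big_nat1.
apply/rowP => l; rewrite /euler_lagrange_coef !mxE /cst !succnK.
(* what remains is a polynomial identity in f, the curvatures, their
   derivatives and the frame coordinates, all independent variables *)
move: (derive1 f t) (derive1n 2 f t) (derive1n 3 f t) (derive1 (k 1%N) t)
  (derive1n 2 (k 1%N) t) (derive1 (k 2%N) t) => f' f'' f''' k1' k1'' k2'.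
by ring.
Qed.

End FrenetCurve.

Theorem theorem3p16 (R : realType) (m : nat) (I : set R)
    (gam : R -> 'rV[R]_m.+1) (E : nat -> R -> 'rV[R]_m.+1)
    (k : nat -> R -> R) (f : R -> R)
    (I_open : open I) (I_itv : is_interval I)
    (gam_curve : arclength_curve (@hyperbolic_metric R m)
       (@hyperbolic_space R m) I gam)
    (gam_frenet : frenet_frame (@hyperbolic_metric R m) I gam E k)
    (f_smooth : smooth_on I f) (f_gt0 : forall t : R, I t -> 0 < f t) :
  bi_f_harmonic (@hyperbolic_metric R m) I gam f <->
  (forall t : R, I t ->
    [/\ - 3 * k 1%N t * derive1 (k 1%N) t * f t ^+ 2
        - 4 * k 1%N t ^+ 2 * f t * derive1 f t
        + f t * derive1n 3 f t + derive1 f t * derive1n 2 f t = 0,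
        - k 1%N t ^+ 3 * f t ^+ 2 - k 1%N t * k 2%N t ^+ 2 * f t ^+ 2
        + derive1n 2 (k 1%N) t * f t ^+ 2 - k 1%N t * f t ^+ 2
        + 4 * derive1 (k 1%N) t * f t * derive1 f t
        + 3 * k 1%N t * f t * derive1n 2 f t
        + 2 * k 1%N t * derive1 f t ^+ 2 = 0,
        2 * derive1 (k 1%N) t * k 2%N t * f t + k 1%N t * derive1 (k 2%N) t * f t
        + 4 * k 1%N t * k 2%N t * derive1 f t = 0 &
        k 1%N t * k 2%N t * k 3%N t = 0]).
Proof.
have gamH : forall t, I t -> 0 < gam t 0 ord_max by case: gam_curve.
have ELE t (It : I t) := euler_lagrange_frenet I_open gam_frenet f_smooth
  (ltn0Sn m) It (fun u v w => hyperbolic_curvature u v w (lt0r_neq0 (gamH t It))).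
split=> [EL t It|sys t It]; last first.
  have [e1 e2 e3 e4] := sys t It.
  apply: etrans (ELE t It) _; rewrite 3?big_nat_recl // big_nat1.
  have c1 : euler_lagrange_coef k f t 1 = 0 := e1.
  have c2 : euler_lagrange_coef k f t 2 = 0 := e2.
  have c3 : euler_lagrange_coef k f t 3 = 0 := etrans (congr1 _ e3) (mulr0 _).
  have c4 : euler_lagrange_coef k f t 4 = 0 := etrans (congr1 _ e4) (mulr0 _).
  by rewrite c1 c2 c3 c4 !scale0r !addr0.
have coef0 := frame_free gam_frenet It
  (fun r => euler_lagrange_coef_out I_open gam_frenet f (ltn0Sn m) It)
  (etrans (esym (ELE t It)) (EL t It)).
have f_neq0 := lt0r_neq0 (f_gt0 t It).
split; [exact: (coef0 1) | exact: (coef0 2) | |].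
- by have /eqP := coef0 3 isT; rewrite mulf_eq0 (negPf f_neq0) => /eqP.
- by have /eqP := coef0 4 isT; rewrite mulf_eq0 expf_eq0 (negPf f_neq0) => /eqP.
Qed.
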